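(* Suppose $\mathcal{P}$ is a hereditary graph property such that for any $G\in\mathcal{P}$ with at least $2$ vertices, there exists a proper induced subgraph $H\neq\emptyset$ of $G$ (i.e. with $\emptyset\ne V(H)\subsetneq V(G)$) such that for all $n\ge 1$, $[G]^n_H\cup[G]^n_H\cup\overline{K}_n\in\mathcal{P}$. Then $\mathcal{P}$ is uniform.
   Context: Graphs are simple and undirected. $G_1\cup G_2$ denotes the disjoint union of graphs $G_1$ and $G_2$, and $\overline{K}_n$ is the graph with $n$ vertices and no edges. If $H$ is an induced subgraph of $G$, then $[G]^n_H$ is the graph obtained by taking $n$ disjoint copies of $G$ and identifying the corresponding subgraphs $H$ from each copy (so it has $n|V(G)\setminus V(H)|+|V(H)|$ vertices). A graph property $\mathcal{P}$ is a collection of finite labelled graphs closed under isomorphism; it is hereditary if every induced subgraph of a graph in $\mathcal{P}$ is in $\mathcal{P}$. A random ordering of a finite graph $G$ is a probability distribution on the set of all total orderings of $V(G)$. A consistent random ordering model on a hereditary property $\mathcal{P}$ assigns to each $G\in\mathcal{P}$ a random ordering $\mathbb{P}_G$ of $V(G)$ such that whenever $H,G\in\mathcal{P}$ and $\phi$ is an isomorphism from $H$ onto an induced subgraph of $G$, then for all $x_1,\dots,x_k\in V(H)$, $\mathbb{P}_H(x_1<x_2<\dots<x_k)=\mathbb{P}_G(\phi(x_1)<\phi(x_2)<\dots<\phi(x_k))$. The uniform model takes $\mathbb{P}_G$ to be the uniform distribution on all $|V(G)|!$ orderings for each $G\in\mathcal{P}$; it is consistent. The property $\mathcal{P}$ is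 called uniform if the uniform model is the only consistent random ordering model on $\mathcal{P}$. *)

(* Defs.v *)
From HB Require Import structures.
From mathcomp Require Import all_boot all_order all_algebra.
From mathcomp Require Import reals.

Set Implicit Arguments.
Unset Strict Implicit.
Unset Printing Implicit Defensive.

Import Order.TTheory GRing.Theory Num.Theory.
Local Open Scope ring_scope.

Record sgraph := SGraph {
  vertex :> finType;
  adj : rel vertex;
  adj_sym : symmetric adj;
  adj_irr : irreflexive adj }.

Section GraphConstructions.

Variables (G : sgraph) (S : {set G}).

Definition induced_adj : rel {x : G | x \in S} :=
  fun u v => adj (val u) (val v).

Lemma induced_adj_sym : symmetric induced_adj.
Proof. by move=> u v; exact: adj_sym. Qed.

Lemma induced_adj_irr : irreflexive induced_adj.
Proof. by move=> u; exact: adj_irr. Qed.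

Definition induced : sgraph := SGraph induced_adj_sym induced_adj_irr.

(* The vertex [inl (i, x)] is the [i]-th copy of the vertex [x] outside [S];
   the vertex [inr x] is the common image of all copies of [x] in [S]. *)
Definition amalgam_vertex (n : nat) : finType :=
  ('I_n * {x : G | x \notin S} + {x : G | x \in S})%type.

Definition amalgam_adj n : rel (amalgam_vertex n) := fun u v =>
  match u, v with
  | inl (i, x), inl (j, y) => (i == j) && adj (val x) (val y)
  | inl (_, x), inr y => adj (val x) (val y)
  | inr x, inl (_, y) => adj (val x) (val y)
  | inr x, inr y => adj (val x) (val y)
  end.

Lemma amalgam_adj_sym n : symmetric (@amalgam_adj n).
Proof.
by move=> [[i x]|x] [[j y]|y] /=; rewrite adj_sym // eq_sym.
Qed.

Lemma amalgam_adj_irr n : irreflexive (@amalgam_adj n).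
Proof. by move=> [[i x]|x] /=; rewrite adj_irr ?andbF. Qed.

(* [G]^n_H, with H the subgraph of G induced on S *)
Definition amalgam n : sgraph :=
  SGraph (@amalgam_adj_sym n) (@amalgam_adj_irr n).

End GraphConstructions.

Section DisjointUnion.

Variables G1 G2 : sgraph.

Definition disjoint_union_adj : rel (G1 + G2)%type := fun u v =>
  match u, v with
  | inl x, inl y => adj x y
  | inr x, inr y => adj x y
  | _, _ => false
  end.

Lemma disjoint_union_adj_sym : symmetric disjoint_union_adj.
Proof. by move=> [x|x] [y|y] //=; exact: adj_sym. Qed.

Lemma disjoint_union_adj_irr : irreflexive disjoint_union_adj.
Proof. by move=> [x|x]; exact: adj_irr. Qed.

Definition disjoint_union : sgraph :=
  SGraph disjoint_union_adj_sym disjoint_union_adj_irr.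

End DisjointUnion.

Definition edgeless (n : nat) : sgraph :=
  @SGraph 'I_n (fun _ _ => false) (fun _ _ => erefl) (fun _ => erefl).

(* Equivalently, [phi] is an isomorphism from [H] onto the subgraph of [G]
   induced on the image of [phi]. *)
Definition induced_embedding (H G : sgraph) (phi : H -> G) : Prop :=
  injective phi /\ forall x y, adj (phi x) (phi y) = adj x y.

Definition isomorphic (H G : sgraph) : Prop :=
  exists phi : H -> G,
    bijective phi /\ forall x y, adj (phi x) (phi y) = adj x y.

Definition graph_property (P : sgraph -> Prop) : Prop :=
  forall H G, isomorphic H G -> P H -> P G.

Definition hereditary (P : sgraph -> Prop) : Prop :=
  forall (G : sgraph) (S : {set G}), P G -> P (induced S).

Definition is_total_ordering (V : finType) (r : {set V * V}) : bool :=
  [&& [forall x, (x, x) \notin r],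
      [forall x, forall y, forall z,
        ((x, y) \in r) ==> ((y, z) \in r) ==> ((x, z) \in r)]
    & [forall x, forall y, (x != y) ==> ((x, y) \in r) || ((y, x) \in r)]].

(* A total ordering is represented by its strict part,
   the set of the pairs (x, y) such that x < y. *)
Record total_ordering (V : finType) := TotalOrdering {
  ordering_set : {set V * V};
  ordering_setP : is_total_ordering ordering_set }.

HB.instance Definition _ (V : finType) :=
  [isSub for @ordering_set V].
HB.instance Definition _ (V : finType) :=
  [Countable of total_ordering V by <:].
HB.instance Definition _ (V : finType) :=
  [Finite of total_ordering V by <:].

Definition ordering_lt (V : finType) (o : total_ordering V) : rel V :=
  fun x y => (x, y) \in ordering_set o.

Record random_ordering (R : realType) (V : finType) := RandomOrdering {
  ordering_mass :> total_ordering V -> R;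
  ordering_mass_ge0 : forall o, 0 <= ordering_mass o;
  ordering_mass_sum1 : \sum_o ordering_mass o = 1 }.

(* The probability that x_1 < x_2 < ... < x_k, for s = [:: x_1; ...; x_k] *)
Definition prob_chain (R : realType) (V : finType)
    (mu : random_ordering R V) (s : seq V) : R :=
  \sum_(o | sorted (ordering_lt o) s) mu o.

Section UniformOrdering.

Variables (R : realType) (V : finType).

Lemma total_ordering_gt0 : (0 < #|{: total_ordering V}|)%N.
Proof.
pose r := [set p : V * V | (enum_rank p.1 < enum_rank p.2)%N].
suff rP : is_total_ordering r by apply/card_gt0P; exists (TotalOrdering rP).
apply/and3P; split.
- by apply/forallP => x; rewrite inE ltnn.
- apply/'forall_forallP => x y; apply/forallP => z; rewrite !inE /=.
  by apply/implyP => xy; apply/implyP; exact: ltn_trans.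
- apply/'forall_forallP => x y; apply/implyP => xy; rewrite !inE /=.
  by rewrite -neq_ltn (inj_eq val_inj) (inj_eq enum_rank_inj).
Qed.

Definition uniform_mass (o : total_ordering V) : R :=
  #|{: total_ordering V}|%:R^-1.

Lemma uniform_mass_ge0 o : 0 <= uniform_mass o.
Proof. by rewrite invr_ge0 ler0n. Qed.

Lemma uniform_mass_sum1 : \sum_o uniform_mass o = 1.
Proof.
rewrite sumr_const -[LHS]mulr_natr mulVf //.
by rewrite pnatr_eq0 -lt0n total_ordering_gt0.
Qed.

Definition uniform_ordering : random_ordering R V :=
  RandomOrdering uniform_mass_ge0 uniform_mass_sum1.

End UniformOrdering.

Definition ordering_model (R : realType) (P : sgraph -> Prop) :=
  forall G : sgraph, P G -> random_ordering R G.

Definition consistent (R : realType) (P : sgraph -> Prop)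
    (M : ordering_model R P) : Prop :=
  forall (H G : sgraph) (PH : P H) (PG : P G) (phi : H -> G),
    induced_embedding phi ->
    forall s : seq H, prob_chain (M H PH) s = prob_chain (M G PG) (map phi s).

Definition uniform_model (R : realType) (P : sgraph -> Prop) :
  ordering_model R P := fun G _ => uniform_ordering R G.

Definition uniform_property (R : realType) (P : sgraph -> Prop) : Prop :=
  consistent (@uniform_model R P) /\
  forall M : ordering_model R P, consistent M ->
    forall (G : sgraph) (PG : P G), M G PG =1 uniform_model R PG.

(* Main.v *)
Require Import Defs.
From mathcomp Require Import all_boot all_order all_algebra all_fingroup.
From mathcomp Require Import reals.
From mathcomp Require Import zify ring lra.

Set Implicit Arguments.
Unset Strict Implicit.
Unset Printing Implicit Defensive.

Import Order.TTheory GRing.Theory Num.Theory.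
Local Open Scope ring_scope.

(** A random ordering of a graph with many further isolated vertices gives each
    vertex a label in [0, 1], its position among those isolated vertices; these
    are exchangeable, hence spread evenly in the limit.  The theorem amounts to
    the independence and uniformity of the labels of the vertices of a graph.

    Let [H] be the subgraph of [G] that the hypothesis provides, and let [T] be
    the set of the vertices of [G] outside [H].  In the amalgam of [n] copies of
    [G] over [H], the [n] copies of [T] have the same joint law with [H].  By
    induction applied to two disjoint copies of [T], any two of the copies of [T]
    have independent uniform labels, so the empirical distribution of the labels
    of the copies of [T] is nearly deterministic, by the second moment method.
    Being nearly constant, it is independent of the labels of [H], which means
    that the labels of one copy of [T] are independent of those of [H].  The
    latter are independent and uniform by induction, so this settles [G].
    The induction must supply two disjoint copies of a graph at a time, and this
    is why the hypothesis provides two disjoint amalgams.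

    To keep all the events finite, every vertex [x] receives [N] isolated
    vertices of its own (graph [aug]) and the label of [x] is replaced by its
    rank among them ([rank]).  The independence claim ([rank_law]) is then an
    exact identity for each [N].  The induction step is [rank_law_extend], which
    rests on the inequality [averaging]; the induction is [rank_law_double]; one
    vertex alone is settled by the exchangeability of isolated vertices
    ([rank_law_isolated]).

    For large [N] the ranks determine the ordering with high probability
    ([ordering_vs_ranks]), so two consistent models whose ranks have the same law
    are equal ([rank_law_unique]).  This is applied to the given model and to the
    uniform one. *)

(** * Total orderings and their pullbacks *)

Section Orderings.

Variable V : finType.
Implicit Types (o : total_ordering V) (x y : V).

Lemma ordering_irr o : irreflexive (ordering_lt o).
Proof.
by move=> x; case/and3P: (ordering_setP o) => /forallP/(_ x)/negbTE.
Qed.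

Lemma ordering_trans o : transitive (ordering_lt o).
Proof.
move=> y x z xy yz; case/and3P: (ordering_setP o) => _.
move=> /forallP/(_ x)/forallP/(_ y)/forallP/(_ z).
by move=> /implyP/(_ xy)/implyP/(_ yz).
Qed.

Lemma ordering_ltN o x y :
  x != y -> ordering_lt o y x = ~~ ordering_lt o x y.
Proof.
move=> xy; case/and3P: (ordering_setP o) => _ _.
move=> /forallP/(_ x)/forallP/(_ y)/implyP/(_ xy).
rewrite -!/(ordering_lt _ _ _); case: (boolP (ordering_lt o x y)) => //= lxy _.
by apply/negP => lyx; have := ordering_trans lxy lyx; rewrite ordering_irr.
Qed.

Lemma sub_ordering_eq o o' :
  (forall x y, ordering_lt o x y -> ordering_lt o' x y) -> o = o'.
Proof.
move=> sub; apply/val_inj/setP => -[x y] /=.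
rewrite -!/(ordering_lt _ _ _).
have [->|xy] := eqVneq x y; first by rewrite !ordering_irr.
apply/idP/idP; first exact: sub.
apply: contraLR; rewrite -ordering_ltN // => lyx.
by rewrite -ordering_ltN //; apply: sub.
Qed.

Lemma exists_sorted_perm o (s : seq V) : uniq s ->
  exists2 t, perm_eq t s & sorted (ordering_lt o) t.
Proof.
move=> us; pose le x y := (x == y) || ordering_lt o x y.
have le_total : total le.
  move=> x y; rewrite /le eq_sym; case: (eqVneq y x) => //= yx.
  by rewrite -[X in _ || X]negbK -ordering_ltN ?orbN.
exists (sort le s); first by rewrite perm_sort.
have: sorted le (sort le s) by exact: sort_sorted.
have: uniq (sort le s) by rewrite sort_uniq.
case: (sort le s) => //= x t; elim: t x => //= y t IH x.
rewrite inE negb_or /le => /andP[/andP[/negbTE-> _]] uyt /=.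
by move=> /andP[-> p]; apply: IH.
Qed.

End Orderings.

Section Pullback.

Variables (V W : finType) (phi : V -> W) (phi_inj : injective phi).

Lemma pullback_subproof (o : total_ordering W) :
  is_total_ordering [set p : V * V | ordering_lt o (phi p.1) (phi p.2)].
Proof.
apply/and3P; split.
- by apply/forallP => x; rewrite inE ordering_irr.
- apply/'forall_forallP => x y; apply/forallP => z; rewrite !inE /=.
  by apply/implyP => xy; apply/implyP; apply: ordering_trans.
- apply/'forall_forallP => x y; apply/implyP => xy; rewrite !inE /=.
  by rewrite (@ordering_ltN _ o (phi x)) ?orbN // (inj_eq phi_inj).
Qed.

Definition pullback (o : total_ordering W) : total_ordering V :=
  TotalOrdering (pullback_subproof o).

Lemma pullbackE o x y :
  ordering_lt (pullback o) x y = ordering_lt o (phi x) (phi y).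
Proof. by rewrite [LHS]inE. Qed.

End Pullback.

(** * Finite expectations *)

Section Expectation.

Variables (R : realType) (V : finType) (mu : random_ordering R V).
Implicit Types (f g : total_ordering V -> R) (A B : pred (total_ordering V)).

Definition expect f : R := \sum_o mu o * f o.

Definition prob A : R := expect (fun o => (A o)%:R).

Lemma eq_expect f g : f =1 g -> expect f = expect g.
Proof. by move=> fg; apply: eq_bigr => o _; rewrite fg. Qed.

Lemma eq_prob A B : A =1 B -> prob A = prob B.
Proof. by move=> AB; apply: eq_expect => o; rewrite AB. Qed.

Lemma le_expect f g : (forall o, f o <= g o) -> expect f <= expect g.
Proof.
move=> fg; apply: ler_sum => o _; apply: ler_wpM2l => //.
exact: ordering_mass_ge0.
Qed.

Lemma expect_cst c : expect (fun=> c) = c.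
Proof. by rewrite /expect -mulr_suml ordering_mass_sum1 mul1r. Qed.

Lemma expectD f g : expect (fun o => f o + g o) = expect f + expect g.
Proof. by rewrite -big_split; apply: eq_bigr => o _; rewrite mulrDr. Qed.

Lemma expectZ c f : expect (fun o => c * f o) = c * expect f.
Proof. by rewrite mulr_sumr; apply: eq_bigr => o _; rewrite mulrCA. Qed.

Lemma expectN f : expect (fun o => - f o) = - expect f.
Proof. by rewrite -sumrN; apply: eq_bigr => o _; rewrite mulrN. Qed.

Lemma expectB f g : expect (fun o => f o - g o) = expect f - expect g.
Proof. by rewrite expectD expectN. Qed.

Lemma expect_sum (I : Type) (r : seq I) (Q : pred I)
    (F : I -> total_ordering V -> R) :
  expect (fun o => \sum_(i <- r | Q i) F i o) =
  \sum_(i <- r | Q i) expect (F i).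
Proof.
rewrite /expect exchange_big /=; apply: eq_bigr => o _.
by rewrite mulr_sumr.
Qed.

Lemma prob_pred1 o : prob (pred1 o) = mu o.
Proof.
rewrite /prob /expect (bigD1 o) //= eqxx mulr1 big1 ?addr0 // => o' /negbTE ->.
by rewrite mulr0.
Qed.

(** Cauchy-Schwarz against an indicator: the variance of [1_B f] is
    nonnegative and [1_B f] is dominated by [f] in absolute value. *)
Lemma sqr_expect_indic B f :
  expect (fun o => (B o)%:R * f o) ^+ 2 <= expect (fun o => f o ^+ 2).
Proof.
set m := expect (fun o => _ * _).
apply: (@le_trans _ _ (expect (fun o => ((B o)%:R * f o) ^+ 2))); last first.
  apply: le_expect => o; case: (B o); rewrite ?mul1r // mul0r expr0n /=.
  exact: sqr_ge0.
have: 0 <= expect (fun o => ((B o)%:R * f o - m) ^+ 2).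
  by rewrite -(expect_cst 0); apply: le_expect => o; apply: sqr_ge0.
rewrite (@eq_expect _ (fun o => ((B o)%:R * f o) ^+ 2 +
  (m ^+ 2 - (2 * m) * ((B o)%:R * f o)))); last by move=> o; ring.
rewrite expectD expectB expectZ expect_cst -/m; lra.
Qed.

(** Chebyshev's inequality. *)
Lemma prob_tail A f (g : R) : 0 < g -> (forall o, A o -> g <= f o) ->
  prob A * g ^+ 2 <= expect (fun o => f o ^+ 2).
Proof.
move=> g0 Af; rewrite mulrC -expectZ; apply: le_expect => o.
case: (boolP (A o)) => [/Af gf|_]; last by rewrite mulr0 sqr_ge0.
by rewrite mulr1 lerXn2r ?nnegrE; lra.
Qed.

(** The averaging step.  The sum of the [n] centred indicators
    has second moment at most [n], as they are pairwise uncorrelated; hence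
    the average over [i] of [1_(A i)] is close to [p] in the square mean, and
    an event [B] cannot be correlated with all the [A i] in the same way
    unless it is uncorrelated with them. *)
Lemma averaging n (B : pred (total_ordering V))
    (A : 'I_n -> pred (total_ordering V)) (c p : R) :
    (forall i, prob (fun o => B o && A i o) = c) ->
    (forall i, prob (A i) = p) ->
    (forall i j, i != j -> prob (fun o => A i o && A j o) = p ^+ 2) ->
  n%:R * (c - p * prob B) ^+ 2 <= 1.
Proof.
move=> EBA EA EAA.
pose D o : R := \sum_i ((A i o)%:R - p).
have EA' i : expect (fun o => (A i o)%:R) = p by exact: EA.
have EAA' i j : i != j -> expect (fun o => (A i o && A j o)%:R) = p ^+ 2.
  by move=> ij; exact: EAA.
have p01 (i : 'I_n) : 0 <= p <= 1.
  rewrite -(EA i); apply/andP; split.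
    by rewrite -(expect_cst 0); apply: le_expect => o; rewrite ler0n.
  by rewrite -[X in _ <= X](expect_cst 1); apply: le_expect => o; case: (A i o).
have EBD : expect (fun o => (B o)%:R * D o) = n%:R * (c - p * prob B).
  under eq_expect => o do rewrite /D mulr_sumr.
  rewrite expect_sum /= (eq_bigr (fun=> c - p * prob B)); last first.
    move=> i _; rewrite -[in RHS](EBA i) -expectZ -expectB.
    by apply: eq_expect => o; case: (B o); case: (A i o); rewrite /=; ring.
  by rewrite sumr_const card_ord mulr_natl.
have ED2 : expect (fun o => D o ^+ 2) <= n%:R.
  rewrite (@eq_expect _ (fun o => \sum_i \sum_j
    ((A i o)%:R - p) * ((A j o)%:R - p))); last first.
    move=> o; rewrite expr2 /D mulr_suml; apply: eq_bigr => i _.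
    by rewrite mulr_sumr.
  rewrite expect_sum /=.
  apply: (@le_trans _ _ (\sum_(i < n) 1)); last by rewrite sumr_const card_ord.
  apply: ler_sum => i _; rewrite expect_sum /= (bigD1 i) //= [X in _ + X]big1.
    rewrite addr0.
    rewrite (@eq_expect _ (fun o => p ^+ 2 + (1 - 2 * p) * (A i o)%:R)).
      rewrite expectD expect_cst expectZ EA'.
      by case/andP: (p01 i) => p0 p1; clear -p0 p1; nra.
    by move=> o; case: (A i o); rewrite /=; ring.
  move=> j ji; rewrite (@eq_expect _ (fun o => p ^+ 2 - p * (A i o)%:R +
     (- p * (A j o)%:R + (A i o && A j o)%:R))).
    rewrite !expectD expect_cst expectN !expectZ.
    rewrite !EA' EAA'; last by rewrite eq_sym.
    by ring.
  by move=> o; case: (A i o); case: (A j o); rewrite /=; ring.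
have := sqr_expect_indic B D; rewrite EBD exprMn => /le_trans/(_ ED2).
have [-> _|n_gt0] := posnP n; first by rewrite mul0r.
have n0 : 0 < n%:R :> R by rewrite ltr0n.
by move=> ?; rewrite -(ler_pM2l n0) mulr1 mulrA -expr2.
Qed.

End Expectation.

Lemma eq0_of_mulrn_le (R : realType) (x b : R) (n0 : nat) :
  (forall n, (n0 <= n)%N -> n%:R * x <= b) -> x <= 0.
Proof.
move=> H; rewrite leNgt; apply/negP => x0.
set m := maxn n0 (Num.bound (b / x)).
have := H m (leq_maxl _ _); rewrite -ler_pdivlMr // leNgt => /negP; apply.
have [b0|b0] := leP 0 (b / x); last first.
  by apply: lt_le_trans b0 _; rewrite ler0n.
by apply: lt_le_trans (archi_boundP b0) _; rewrite ler_nat leq_maxr.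
Qed.

(** * Consistency as invariance under pullback *)

Lemma full_chain (V : finType) (o : total_ordering V) :
  exists s : seq V, forall o', sorted (ordering_lt o') s = (o' == o).
Proof.
have [s ps so] := exists_sorted_perm o (enum_uniq V).
have ms x : x \in s by rewrite (perm_mem ps) mem_enum.
exists s => o'; apply/idP/eqP => [so'|->//].
apply/esym/sub_ordering_eq => x y lxy.
have xy : x != y by apply: contraTneq lxy => ->; rewrite ordering_irr.
have lt_index := fun o => sorted_ltn_index (@ordering_trans _ o).
have [lt|lt|eq] := ssrnat.ltngtP (index x s) (index y s).
- exact: (lt_index _ _ _ so' x y).
- by have := ordering_ltN o xy; rewrite lxy (lt_index _ _ _ so y x).
- by rewrite -(nth_index x (ms x)) eq nth_index ?eqxx in xy.
Qed.

Lemma sorted_pullback (V W : finType) (phi : V -> W) (phi_inj : injective phi)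
    (o : total_ordering W) (s : seq V) :
  sorted (ordering_lt o) (map phi s) =
  sorted (ordering_lt (pullback phi_inj o)) s.
Proof.
by rewrite sorted_map; apply: eq_sorted => x y; rewrite pullbackE.
Qed.

(** The ordering of an induced subgraph is distributed as the restriction of the
    ordering of the whole graph: consistency gives this for the chains, and the
    chains through all the vertices single out the orderings. *)
Lemma expect_pullback (R : realType) (P : sgraph -> Prop)
    (M : ordering_model R P) (M_consistent : consistent M) (H G : sgraph)
    (PH : P H) (PG : P G) (phi : H -> G) (phi_emb : induced_embedding phi)
    (f : total_ordering H -> R) :
  expect (M H PH) f =
  expect (M G PG) (fun o => f (pullback (proj1 phi_emb) o)).
Proof.
have push o : M H PH o =
    \sum_(o' | pullback (proj1 phi_emb) o' == o) M G PG o'.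
  have [s os] := full_chain o.
  transitivity (prob_chain (M H PH) s).
    by rewrite /prob_chain (eq_bigl _ _ os) big_pred1_eq.
  rewrite (M_consistent H G PH PG phi phi_emb s); apply: eq_bigl => o'.
  by rewrite (sorted_pullback (proj1 phi_emb)) os.
rewrite /expect [RHS](partition_big (pullback (proj1 phi_emb)) predT) //=.
apply: eq_bigr => o _; rewrite push mulr_suml.
by apply: eq_bigr => o' /eqP ->.
Qed.

Lemma prob_pullback (R : realType) (P : sgraph -> Prop)
    (M : ordering_model R P) (M_consistent : consistent M) (H G : sgraph)
    (PH : P H) (PG : P G) (phi : H -> G) (phi_emb : induced_embedding phi)
    (A : pred (total_ordering H)) :
  prob (M H PH) A =
  prob (M G PG) (fun o => A (pullback (proj1 phi_emb) o)).
Proof. exact: expect_pullback. Qed.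

Lemma induced_embedding_closed (P : sgraph -> Prop) :
  graph_property P -> hereditary P ->
  forall (H G : sgraph) (phi : H -> G), induced_embedding phi -> P G -> P H.
Proof.
move=> P_iso P_her H G phi [phi_inj phi_adj] PG.
pose S := [set phi x | x in [set: H]].
apply: (P_iso (induced S)); last exact: P_her.
have phiS x : phi x \in S by apply: imset_f.
pose psi x : induced S := Sub (phi x) (phiS x).
have psi_bij : bijective psi.
  apply: inj_card_bij; first by move=> x y /(congr1 val)/phi_inj.
  rewrite card_sig (eq_card (_ : _ =i S)); last by move=> x; rewrite !inE.
  by rewrite card_imset // cardsT.
have [psi' psiK psi'K] := psi_bij; exists psi'; split; first by exists psi.
by move=> x y; rewrite -phi_adj -[in RHS](psi'K x) -[in RHS](psi'K y).
Qed.

(** The permutations of a sequence of distinct points are equally likely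
    under the uniform ordering, and every ordering sorts exactly one of them. *)
Lemma prob_chain_uniform (R : realType) (V : finType) (s : seq V) :
  prob_chain (uniform_ordering R V) s =
  if uniq s then (size s)`!%:R^-1 else 0.
Proof.
case: ifPn => us; last first.
  rewrite /prob_chain big_pred0 // => o; apply: contraNF us.
  exact: sorted_uniq (@ordering_trans _ o) (@ordering_irr _ o) _.
have chain_perm t : t \in permutations s ->
    prob_chain (uniform_ordering R V) t = prob_chain (uniform_ordering R V) s.
  rewrite mem_permutations => pts; have szt := perm_size pts.
  have ut : uniq t by rewrite (perm_uniq pts).
  have mt := perm_mem pts.
  (* For x outside s the index is size s = size t, and the default x is read. *)
  pose sigma x := nth x t (index x s).
  have sigma_s x : (sigma x \in s) = (x \in s).
    rewrite /sigma -mt; have [xs|xs] := boolP (x \in s).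
      by rewrite mem_nth // szt index_mem.
    by rewrite nth_default ?mt ?(negbTE xs) // (memNindex xs) szt.
  have sigma_inj : injective sigma.
    move=> x y eq_xy; have := sigma_s x; rewrite eq_xy sigma_s.
    have [xs ys|xs ys] := boolP (x \in s); last first.
      by move: eq_xy; rewrite /sigma !nth_default ?memNindex ?szt // ys.
    have ix : (index x s < size t)%N by rewrite szt index_mem.
    have iy : (index y s < size t)%N by rewrite szt index_mem.
    move: eq_xy; rewrite /sigma (set_nth_default x y iy) => /eqP.
    rewrite nth_uniq // => /eqP eq_i.
    by rewrite -(nth_index x xs) eq_i nth_index.
  have -> : t = map sigma s.
    case: s us pts szt mt @sigma {sigma_s sigma_inj} => [|x0 s] us _ szt.
      by rewrite (size0nil szt).
    move=> _ sigma; apply: (@eq_from_nth _ x0); first by rewrite size_map.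
    move=> i it; rewrite (nth_map x0) -?szt // /sigma.
    by rewrite index_uniq -?szt //; apply: set_nth_default.
  rewrite /prob_chain [RHS](reindex_inj (h := pullback sigma_inj)); last first.
    have [tau _ sigmaK] := injF_bij sigma_inj.
    move=> o o' eq_o; apply: sub_ordering_eq => x y.
    by rewrite -(sigmaK x) -(sigmaK y) -!(pullbackE sigma_inj) eq_o.
  by apply: eq_big => [o|//]; rewrite (sorted_pullback sigma_inj).
have sum1 : \sum_(t <- permutations s) prob_chain (uniform_ordering R V) t = 1.
  rewrite -(ordering_mass_sum1 (uniform_ordering R V)) /prob_chain.
  under eq_bigr => t _ do rewrite big_mkcond.
  rewrite exchange_big; apply: eq_bigr => o _; rewrite -big_mkcond /=.
  have [t0 pt0 so] := exists_sorted_perm o us.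
  rewrite -big_filter (_ : [seq t <- _ | _] = [:: t0]) ?big_seq1 //.
  rewrite -(@filter_pred1_uniq _ (permutations s) t0); last 2 first.
  - exact: permutations_uniq.
  - by rewrite mem_permutations.
  apply: eq_in_filter => t; rewrite mem_permutations => pt.
  apply/idP/eqP => [st|->//].
  apply: (irr_sorted_eq (@ordering_trans _ o) (@ordering_irr _ o)) => // x.
  by rewrite (perm_mem pt) (perm_mem pt0).
have fact_neq0 : (size s)`!%:R != 0 :> R by rewrite pnatr_eq0 -lt0n fact_gt0.
move: sum1; rewrite big_seq (eq_bigr _ chain_perm) -big_seq big_const_seq.
rewrite count_predT size_permutations // iter_addr_0 => sum1.
by rewrite -[LHS](mulfK fact_neq0) mulr_natr sum1 mul1r.
Qed.

Lemma uniform_model_consistent (R : realType) (P : sgraph -> Prop) :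
  consistent (@uniform_model R P).
Proof.
move=> H G PH PG phi [phi_inj _] s.
by rewrite !prob_chain_uniform map_inj_uniq // size_map.
Qed.

(** * Ranks among dedicated isolated vertices *)

Section Augmentation.

Variables (G : sgraph) (N : nat).

Definition aug_adj : rel (G + G * 'I_N)%type := fun u v =>
  if (u, v) is (inl x, inl y) then adj x y else false.

Lemma aug_adj_sym : symmetric aug_adj.
Proof. by move=> [x|x] [y|y] //=; apply: adj_sym. Qed.

Lemma aug_adj_irr : irreflexive aug_adj.
Proof. by move=> [x|x] //=; apply: adj_irr. Qed.

(** The vertices [inr (x, j)] are isolated points, [N] of them being reserved
    for each vertex [x]: they serve to measure the position of [x]. *)
Definition aug : sgraph := SGraph aug_adj_sym aug_adj_irr.

Variable o : total_ordering aug.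

Lemma rank_subproof (x : G) :
  (#|[pred j : 'I_N | ordering_lt o (inr (x, j)) (inl x)]| < N.+1)%N.
Proof. by rewrite ltnS (leq_trans (max_card _)) ?card_ord. Qed.

Definition rank (x : G) : 'I_N.+1 := Ordinal (rank_subproof x).

End Augmentation.

Definition aug_map (H G : sgraph) (N : nat) (phi : H -> G) (u : aug H N) :
    aug G N :=
  match u with inl x => inl (phi x) | inr (x, j) => inr (phi x, j) end.

Lemma aug_map_embedding (H G : sgraph) (N : nat) (phi : H -> G) :
  induced_embedding phi -> induced_embedding (@aug_map H G N phi).
Proof.
move=> [phi_inj phi_adj]; split.
  by move=> [x|[x i]] [y|[y j]] //= []; [move/phi_inj-> | move/phi_inj-> => ->].
by move=> [x|[x i]] [y|[y j]] //=; apply: phi_adj.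
Qed.

Lemma rank_pullback (H G : sgraph) (N : nat) (phi : H -> G)
    (phi_inj : injective (@aug_map H G N phi)) (o : total_ordering (aug G N))
    (x : H) :
  rank (pullback phi_inj o) x = rank o (phi x).
Proof. by apply/val_inj/eq_card => j; rewrite !inE pullbackE. Qed.

Lemma forall_in_imset (I J : finType) (f : I -> J) (A : {set I})
    (Q : pred J) :
  [forall y in f @: A, Q y] = [forall x in A, Q (f x)].
Proof.
apply/forall_inP/forall_inP => QA x; first by move=> xA; apply/QA/imset_f.
by case/imsetP => y yA ->; apply: QA.
Qed.

Lemma forall_in_setU (I : finType) (A B : {set I}) (Q : pred I) :
  [forall x in A :|: B, Q x] = [forall x in A, Q x] && [forall x in B, Q x].
Proof.
apply/forall_inP/andP => [QAB|[/forall_inP QA /forall_inP QB] x].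
  by split; apply/forall_inP => x xA; apply: QAB; rewrite inE xA ?orbT.
by rewrite inE => /orP[/QA|/QB].
Qed.

Section RankLaw.

Variables (R : realType) (P : sgraph -> Prop).
Hypothesis P_closed : forall (H G : sgraph) (phi : H -> G),
  induced_embedding phi -> P G -> P H.
Variable M : ordering_model R P.
Hypothesis M_consistent : consistent M.

(** Independence and uniformity of the labels of [D].  Since no two vertices
    share reserved points, this is a product formula, exact for each [N]. *)
Definition rank_law (K : sgraph) (D : {set K}) : Prop :=
  forall (N : nat) (PN : P (aug K N)) (a : K -> 'I_N.+1),
    prob (M PN) (fun o => [forall x in D, rank o x == a x]) =
    N.+1%:R ^- #|D|.

Lemma rank_law_embedding (K L : sgraph) (D : {set K}) (phi : K -> L) :
  rank_law D -> induced_embedding phi ->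
  forall (N : nat) (PN : P (aug L N)) (a : K -> 'I_N.+1),
    prob (M PN) (fun o => [forall x in D, rank o (phi x) == a x]) =
    N.+1%:R ^- #|D|.
Proof.
move=> lawD phi_emb N PN a; have emb := aug_map_embedding N phi_emb.
rewrite -(lawD N (P_closed emb PN) a) (prob_pullback M_consistent _ PN emb).
by apply: eq_prob => o; apply: eq_forallb => x; rewrite rank_pullback.
Qed.

(** Summing over the possible ranks of [x] forgets [x]. *)
Lemma rank_law_setU1 (K : sgraph) (D : {set K}) (x : K) :
  x \notin D -> rank_law (x |: D) -> rank_law D.
Proof.
move=> xD lawxD N PN a.
pose b c y := if y == x then c else a y.
have split_x o c : [forall y in x |: D, rank o y == b c y] =
    (rank o x == c) && [forall y in D, rank o y == a y].
  rewrite forall_in_setU; congr andb.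
    apply/forall_inP/idP => [/(_ x)|xc y]; rewrite inE; first by rewrite /b eqxx; apply.
    by move/eqP->; rewrite /b eqxx.
  apply: eq_forallb_in => y yD; rewrite /b.
  by rewrite (negbTE (memPn xD y yD)).
rewrite /prob (@eq_expect _ _ _ _ (fun o =>
  \sum_c [forall y in x |: D, rank o y == b c y]%:R)).
  rewrite expect_sum /= (eq_bigr (fun=> N.+1%:R ^- #|x |: D|)); last first.
    by move=> c _; apply: lawxD.
  rewrite sumr_const card_ord cardsU1 xD -[LHS]mulr_natl exprS invfM mulVKf //.
  by rewrite pnatr_eq0.
move=> o; rewrite (bigD1 (rank o x)) //= big1 => [|c cx]; rewrite split_x.
  by rewrite eqxx addr0.
by rewrite eq_sym (negbTE cx).
Qed.

Lemma rank_law_sub (K : sgraph) (D : {set K}) :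
  rank_law [set: K] -> rank_law D.
Proof.
move=> lawT; move Dn: #|~: D| => n.
elim: n D Dn => [|n IHn] D Dn.
  by move/cards0_eq: Dn => /(congr1 (@setC _)); rewrite setCK setC0 => ->.
have [x] : exists x, x \in ~: D by apply/set0Pn; rewrite -card_gt0 Dn.
rewrite inE => xD; apply: (rank_law_setU1 xD); apply: IHn.
by move: Dn; rewrite (cardsD1 x) inE xD setDE setCU setIC => -[].
Qed.

(** The law of large numbers at work: the copies [e i] of [U] have independent
    ranks, so their empirical distribution is nearly deterministic.  The copies
    also have the same joint law with [D], so that the ranks on [U] must be
    independent of those on [D]. *)
Lemma rank_law_extend (K : sgraph) (D U : {set K})
    (L : nat -> sgraph) (e : forall n, 'I_n -> K -> L n) :
    [disjoint D & U] ->
    (forall n N, (1 < n)%N -> P (aug (L n) N)) ->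
    (forall n i, induced_embedding (@e n i)) ->
    (forall n i j x, x \in D -> @e n i x = @e n j x) ->
    (forall n N (PN : P (aug (L n) N)) i j (a : K -> 'I_N.+1), i != j ->
       prob (M PN) (fun o => [forall x in U, rank o (@e n i x) == a x]
         && [forall x in U, rank o (@e n j x) == a x]) =
       (N.+1%:R ^- #|U|) ^+ 2) ->
    (forall n N (PN : P (aug (L n) N)) i (a : K -> 'I_N.+1), (1 < n)%N ->
       prob (M PN) (fun o => [forall x in U, rank o (@e n i x) == a x]) =
       N.+1%:R ^- #|U|) ->
  rank_law D -> rank_law (D :|: U).
Proof.
move=> disDU PL e_emb eD pairU singleU lawD N PN a.
set c := prob _ _.
have sqr_le n : (2 <= n)%N ->
    n%:R * (c - N.+1%:R ^- #|U| * N.+1%:R ^- #|D|) ^+ 2 <= 1.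
  move=> n2; have PLN := PL n N n2; pose i0 := Ordinal (ltnW n2).
  rewrite -(rank_law_embedding lawD (e_emb n i0) PLN a).
  apply: (averaging (A := fun i o =>
    [forall x in U, rank o (e n i x) == a x])) => [i|i|i j ij].
  - rewrite /c; have emb := aug_map_embedding N (e_emb n i).
    rewrite (prob_pullback M_consistent _ PLN emb).
    apply: eq_prob => o; rewrite forall_in_setU; congr andb.
      by apply: eq_forallb_in => x xD; rewrite rank_pullback (eD n i i0).
    by apply: eq_forallb => x; rewrite rank_pullback.
  - exact: singleU.
  - exact: pairU.
have := eq0_of_mulrn_le sqr_le.
rewrite real_exprn_even_le0 //= ?num_real // subr_eq0 => /eqP ->.
by rewrite -invfM -exprD cardsU disjoint_setI0 // cards0 subn0 addnC.
Qed.

End RankLaw.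

(** * Exchanging isolated vertices *)

Lemma tperm_isolated_embedding (G : sgraph) (x y : G) :
    (forall z, adj x z = false) -> (forall z, adj y z = false) ->
  induced_embedding (tperm x y).
Proof.
move=> x_iso y_iso; split; first exact: perm_inj.
have iso z t : (z == x) || (z == y) -> adj z t = false.
  by case/orP => /eqP ->.
move=> u v; case: tpermP => [->|->|/eqP/negbTE ux /eqP/negbTE uy].
- by rewrite !iso ?eqxx ?orbT.
- by rewrite !iso ?eqxx ?orbT.
rewrite !(adj_sym u); case: tpermP => [->|->|//].
- by rewrite !(adj_sym _ u) !(adj_sym u) !iso ?eqxx ?orbT.
- by rewrite !(adj_sym _ u) !(adj_sym u) !iso ?eqxx ?orbT.
Qed.

Section Exchange.

Variables (R : realType) (P : sgraph -> Prop) (M : ordering_model R P).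
Hypothesis M_consistent : consistent M.

(** An isolated vertex [x] can be exchanged with each of its [N] reserved
    points without moving anything else; the positions of these [N + 1] points
    among themselves run through all the possible values once. *)
Lemma rank_law_isolated (K : sgraph) (D : {set K}) (x : K) :
    (forall y, adj x y = false) -> x \notin D ->
  rank_law M D -> rank_law M (x |: D).
Proof.
move=> x_iso xD lawD N PN a.
pose w (k : option 'I_N) : aug K N :=
  if k is Some i then inr (x, i) else inl x.
have w_inj : injective w by move=> [i|] [j|] //= [->].
have w_iso k z : adj (w k) z = false.
  by case: k z => [i|] [z|z] //=; apply: x_iso.
have emb k := tperm_isolated_embedding (w_iso None) (w_iso k).
pose pos o k := rank (pullback (emb k).1 o) x.
(* The pullback puts the k-th point in the place of x, and x among the points
   reserved for it, so pos o k is the position of w k in the range of w. *)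
have posE o k : pos o k = #|[set l | ordering_lt o (w l) (w k)]| :> nat.
  transitivity #|[set l | ordering_lt (pullback (emb k).1 o) (w l) (w None)]|.
    rewrite [LHS](_ : _ = #|Some @: [set i |
      ordering_lt (pullback (emb k).1 o) (w (Some i)) (w None)]|); last first.
      by rewrite card_imset ?cardsE // => ? ? [].
    apply: eq_card => l; rewrite !inE; apply/imsetP/idP => [[i]|].
      by rewrite inE => lt ->.
    case: l => [i lt|]; first by exists i; rewrite ?inE.
    by rewrite ordering_irr.
  rewrite -[RHS](card_preimset _ (@perm_inj _ (tperm None k))).
  apply: eq_card => l; rewrite !inE pullbackE tpermL.
  by rewrite -[tperm (w None) _ _](inj_tperm _ _ _ w_inj).
have pos_inj o : injective (pos o).
  have lt_pos k l : ordering_lt o (w k) (w l) -> (pos o k < pos o l)%N.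
    move=> kl; rewrite !posE; apply: proper_card; apply/properP; split.
      apply/subsetP => m; rewrite !inE => mk.
      exact: ordering_trans mk kl.
    by exists k; rewrite !inE ?ordering_irr.
  move=> k l eq_kl; apply/eqP/negPn/negP => kl.
  have wkl : w k != w l by rewrite (inj_eq w_inj).
  have [/lt_pos|] := boolP (ordering_lt o (w k) (w l)).
    by rewrite eq_kl ltnn.
  by rewrite -ordering_ltN // => /lt_pos; rewrite eq_kl ltnn.
have sum_pos o c : \sum_k (pos o k == c)%:R = 1 :> R.
  have [k0 k0c] : exists k, pos o k = c.
    have [f _ fK] : bijective (pos o).
      by apply: inj_card_bij => //; rewrite card_option !card_ord.
    by exists (f c).
  rewrite (bigD1 k0) //= k0c eqxx big1 ?addr0 // => k kk0.
  by rewrite -k0c (inj_eq (@pos_inj o)) (negbTE kk0).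
have NE : N.+1%:R * prob (M PN)
    (fun o => [forall y in x |: D, rank o y == a y]) = N.+1%:R ^- #|D|.
  have card_N1 : #|{: option 'I_N}| = N.+1 by rewrite card_option card_ord.
  have sum_cst q : N.+1%:R * q = \sum_(k : option 'I_N) q :> R.
    by rewrite sumr_const card_N1 mulr_natl.
  rewrite -(lawD N PN a) sum_cst.
  rewrite (eq_bigr (fun k => prob (M PN) (fun o =>
     [forall y in D, rank o y == a y] && (pos o k == a x)))); last first.
    move=> k _; rewrite (prob_pullback M_consistent PN PN (emb k)).
    apply: eq_prob => o; rewrite forall_in_setU andbC; congr andb.
      apply: eq_forallb_in => y yD; congr (_ == _); apply/val_inj/eq_card => i.
      rewrite !inE pullbackE.
      have yx := memPn xD y yD.
      by rewrite !tpermD //=; case: k; rewrite //= => *; apply/eqP => -[] /eqP;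
        rewrite eq_sym (negbTE yx).
    apply/forall_inP/idP => [/(_ x)|h y]; rewrite inE ?eqxx; first exact.
    by move/eqP->.
  rewrite /prob -expect_sum; apply: eq_expect => o.
  case: [forall y in D, _] => /=; last by rewrite big1.
  exact: sum_pos.
rewrite cardsU1 xD exprS invfM -NE mulKf //.
by rewrite pnatr_eq0.
Qed.

End Exchange.

(** * Ranks determine the ordering in the limit *)

Lemma natr_sub_abs_le (R : realType) (a b : bool) (s : R) :
  0 <= s -> (a != b -> 1 <= s) -> `|a%:R - b%:R| <= s.
Proof.
move=> s0; case: a b => [] [] //= H; rewrite ?subrr ?normr0 //.
  by rewrite subr0 normr1 H.
by rewrite sub0r normrN normr1 H.
Qed.

Lemma card_near (N g i : nat) :
  (#|[pred j : 'I_N.+1 | (i < j + g) && (j < i + g)]| <= 2 * g)%N.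
Proof.
rewrite -[X in (_ <= X)%N]card_ord.
(* The j sought are i - g + t for t < 2g; truncated subtraction comes last. *)
apply: leq_trans (leq_image_card
  (fun t : 'I_(2 * g) => inord (i + t - g) : 'I_N.+1) predT).
apply/subset_leq_card/subsetP => j; rewrite inE => /andP[ij ji].
have t_lt : (j + g - i < 2 * g)%N by lia.
apply/imageP; exists (Ordinal t_lt) => //=; apply/val_inj.
by rewrite /= inordK; have := ltn_ord j; lia.
Qed.

Section RanksDetermine.

Variables (R : realType) (P : sgraph -> Prop) (M : ordering_model R P).
Hypothesis M_consistent : consistent M.

Lemma prob_ranks (L : sgraph) (N : nat) (PN : P (aug L N))
    (Q : pred {ffun L -> 'I_N.+1}) :
  rank_law M [set: L] ->
  prob (M PN) (fun o => Q [ffun x => rank o x]) =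
  \sum_(a : {ffun L -> 'I_N.+1} | Q a) N.+1%:R ^- #|L|.
Proof.
move=> law; rewrite -cardsT.
under eq_bigr => a _ do rewrite -(law N PN a).
rewrite /prob -expect_sum; apply: eq_expect => o.
set r : {ffun L -> 'I_N.+1} := [ffun x => rank o x].
have r_eq (a : {ffun L -> 'I_N.+1}) : [forall x in [set: L], rank o x == a x] = (a == r).
  apply/forall_inP/eqP => [h|-> x _]; last by rewrite ffunE.
  by apply/ffunP => x; rewrite ffunE; apply/esym/eqP/h.
under eq_bigr => a _ do rewrite r_eq.
have [Qr|Qr] := boolP (Q r).
  rewrite (bigD1 r) //= eqxx big1 ?addr0 // => a /andP[_ /negbTE ->] //.
by rewrite big1 // => a Qa; case: eqP Qa => // -> ; rewrite (negbTE Qr).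
Qed.

Definition near_ranks (L : sgraph) (N g : nat) (u v : L)
    (o : total_ordering (aug L N)) : bool :=
  (rank o u < rank o v + g)%N && (rank o v < rank o u + g)%N.

Lemma prob_near_ranks (L : sgraph) (N g : nat) (PN : P (aug L N)) (u v : L) :
    rank_law M [set: L] -> u != v ->
  prob (M PN) (near_ranks g u v) <= (2 * g)%:R / N.+1%:R.
Proof.
move=> law uv; have law2 : rank_law M [set u; v] by apply: rank_law_sub.
pose near (i j : 'I_N.+1) := (i < j + g)%N && (j < i + g)%N.
rewrite /prob (@eq_expect _ _ _ _ (fun o => \sum_i \sum_(j | near i j)
   [forall x in [set u; v], rank o x == if x == u then i else j]%:R)).
  rewrite expect_sum /=.
  apply: (@le_trans _ _ (\sum_(i < N.+1) (2 * g)%:R * N.+1%:R ^- 2)).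
    apply: ler_sum => i _; rewrite expect_sum /=.
    rewrite (eq_bigr (fun=> N.+1%:R ^- 2)); last first.
      move=> j _; have := law2 N PN (fun x => if x == u then i else j).
      by rewrite cards2 uv.
    rewrite sumr_const -[X in X <= _]mulr_natl; apply: ler_wpM2r.
      by rewrite invr_ge0 exprn_ge0 ?ler0n.
    by rewrite ler_nat card_near.
  rewrite sumr_const card_ord -[X in X <= _]mulr_natl.
  have cancel (x y : R) : x != 0 -> x * (y * x ^- 2) = y / x by move=> ?; field.
  by rewrite cancel // pnatr_eq0.
move=> o; pose i0 := rank o u; pose j0 := rank o v.
have pairE i j : [forall x in [set u; v], rank o x == if x == u then i else j]
    = (i == i0) && (j == j0).
  have vu : v != u by rewrite eq_sym.
  rewrite forall_in_setU; congr andb.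
    apply/forall_inP/eqP => [/(_ u)|-> x]; rewrite inE.
      by rewrite !eqxx => /(_ isT)/eqP.
    by move/eqP->; rewrite eqxx.
  apply/forall_inP/eqP => [/(_ v)|-> x]; rewrite inE.
    by rewrite eqxx (negbTE vu) => /(_ isT)/eqP.
  by move/eqP->; rewrite (negbTE vu).
rewrite (bigD1 i0) //= [X in _ + X]big1 ?addr0; last first.
  by move=> i /negbTE ii0; apply: big1 => j _; rewrite pairE ii0.
rewrite /near_ranks -/(near i0 j0).
have [near0|far0] := boolP (near i0 j0).
  rewrite (bigD1 j0) //= pairE !eqxx big1 ?addr0 // => j /andP[_ /negbTE jj0].
  by rewrite pairE jj0 andbF.
rewrite big1 // => j nearj; rewrite pairE eqxx /=.
by case: eqP nearj => // ->; rewrite (negbTE far0).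
Qed.

(** By the law of large numbers this is close to the rank of [u]; when [v]
    precedes [u] it is also at least the rank of [v].  Hence ranks that are not
    close are ordered like the vertices. *)
Definition cross_rank (L : sgraph) (N : nat) (u v : L)
    (o : total_ordering (aug L N)) : nat :=
  #|[pred j : 'I_N | ordering_lt o (inr (v, j)) (inl u)]|.

(** Exchanging the [j]-th points reserved for [u] and for [v] changes the sign
    of the [j]-th term of the difference of the two counts, and of no other
    term: the terms are uncorrelated. *)
Lemma prob_cross_rank (L : sgraph) (N g : nat) (PN : P (aug L N)) (u v : L) :
    u != v ->
  prob (M PN) (fun o => rank o u + g <= cross_rank u v o)%N * g%:R ^+ 2
  <= N%:R.
Proof.
move=> uv; have [->|g_gt0] := posnP g; first by rewrite expr0n mulr0 ler0n.
pose b (w : L) (o : total_ordering (aug L N)) (j : 'I_N) : R :=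
  (ordering_lt o (inr (w, j)) (inl u))%:R.
pose d (o : total_ordering (aug L N)) (j : 'I_N) : R := b v o j - b u o j.
have sum_b w o : \sum_j b w o j = (cross_rank u w o)%:R.
  rewrite /b -natr_sum /cross_rank -sum1_card [in RHS]big_mkcond /=.
  by congr _%:R; apply: eq_bigr => j _; rewrite inE; case: ordering_lt.
apply: le_trans (prob_tail (f := fun o => \sum_j d o j) _ _ _) _.
- by rewrite ltr0n.
- move=> o le_rank; rewrite sumrB !sum_b lerBrDr -natrD ler_nat addnC.
  exact: le_rank.
rewrite (@eq_expect _ _ _ _ (fun o => \sum_j \sum_k d o j * d o k)); last first.
  move=> o; rewrite expr2 mulr_suml; apply: eq_bigr => j _.
  by rewrite mulr_sumr.
rewrite expect_sum /= -[X in _ <= X%:R](card_ord N) -sumr_const.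
apply: ler_sum => j _; rewrite expect_sum /= (bigD1 j) //= big1 ?addr0.
  rewrite -[X in _ <= X](expect_cst (M PN) 1); apply: le_expect => o.
  by rewrite /d /b; do 2![case: ordering_lt] => /=; lra.
move=> k kj.
have emb := @tperm_isolated_embedding (aug L N) (inr (u, j)) (inr (v, j))
  (fun=> erefl) (fun=> erefl).
suff : expect (M PN) (fun o => d o j * d o k) =
       - expect (M PN) (fun o => d o j * d o k) by lra.
rewrite [LHS](expect_pullback M_consistent PN PN emb) -expectN.
apply: eq_expect => o; rewrite -mulNr; congr (_ * _).
  rewrite /d opprB /b !pullbackE tpermL tpermR.
  by rewrite (tpermD (z := inl u)).
rewrite /d /b !pullbackE (tpermD (z := inl u)) //.
have neq w w' : (inr (w, j) : aug L N) != inr (w', k).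
  by apply: contraNneq kj => -[_ ->].
by rewrite !tpermD.
Qed.

Definition spread_along (L : sgraph) (o : total_ordering L) (N g : nat)
    (a : {ffun L -> 'I_N.+1}) : bool :=
  [forall u, forall v, ordering_lt o u v ==> (a u + g <= a v)%N].

Lemma inl_embedding (L : sgraph) (N : nat) :
  @induced_embedding L (aug L N) inl.
Proof. by split => // x y []. Qed.

(** The ordering of the vertices can disagree with that of their ranks only if
    two ranks differ by less than [g], or if a rank differs by at least [g] from
    a count that has the same expectation. *)
Lemma ordering_vs_ranks (L : sgraph) (PL : P L) (N g : nat)
    (PN : P (aug L N)) (o : total_ordering L) :
    rank_law M [set: L] -> (0 < g)%N ->
  `|M PL o - \sum_(a : {ffun L -> 'I_N.+1} | spread_along o g a)
               N.+1%:R ^- #|L| |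
  <= (#|L| ^ 2)%:R * ((2 * g)%:R / N.+1%:R + N%:R / g%:R ^+ 2).
Proof.
move=> law g_gt0; rewrite -(prob_ranks PN (spread_along o g) law).
have emb := inl_embedding L N.
have -> : M PL o = prob (M PN) (fun o' => pullback emb.1 o' == o).
  by rewrite -(prob_pullback M_consistent PL PN emb (pred1 o)) prob_pred1.
pose bad (uv : L * L) (o' : total_ordering (aug L N)) : R :=
  if uv.1 == uv.2 then 0 else (near_ranks g uv.1 uv.2 o')%:R +
    (rank o' uv.1 + g <= cross_rank uv.1 uv.2 o')%N%:R.
have bad_ge0 uv o' : 0 <= bad uv o'.
  by rewrite /bad; case: ifP => // _; rewrite addr_ge0 ?ler0n.
have sum_bad_ge0 (Q : pred (L * L)) o' : 0 <= \sum_(uv | Q uv) bad uv o'.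
  by apply: sumr_ge0 => uv _; apply: bad_ge0.
apply: (@le_trans _ _ (expect (M PN) (fun o' => \sum_uv bad uv o'))).
  rewrite /prob -expectB ler_norml -expectN.
  have ptw o' : `|(pullback emb.1 o' == o)%:R -
      (spread_along o g [ffun x => rank o' x])%:R| <= \sum_uv bad uv o'.
    apply: natr_sub_abs_le => // neq.
    have [uv uv_bad] : exists uv, 1 <= bad uv o'.
      have [[u v] /= uv_bad|none_bad] := pickP (fun uv : L * L =>
        (uv.1 != uv.2) && (near_ranks g uv.1 uv.2 o' ||
          (rank o' uv.1 + g <= cross_rank uv.1 uv.2 o')%N)).
        exists (u, v); move: uv_bad; rewrite /bad /=; case: eqP => //= _.
        by case/orP => ->; rewrite ?lerDl ?lerDr ler0n.
      case/eqP: neq.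
      have sep u v : ordering_lt (pullback emb.1 o') u v ->
          (rank o' u + g <= rank o' v)%N.
        move=> lt_uv; have uv : v != u.
          by apply: contraTneq lt_uv => ->; rewrite ordering_irr.
        have := negbT (none_bad (v, u)); rewrite /= uv /near_ranks /=.
        rewrite negb_or negb_and -!leqNgt -ltnNge => /andP[far cross].
        suff : (rank o' u <= cross_rank v u o')%N.
          move=> le_cross; case/orP: far => // /(leq_trans (leq_ltn_trans le_cross cross)).
          by rewrite ltnn.
        apply/subset_leq_card/subsetP => j; rewrite !inE => lt_ju.
        by apply: ordering_trans lt_ju _; rewrite -(pullbackE emb.1).
      apply/eqP/forallP => [<- u|spread].
        by apply/forallP => v; apply/implyP => /sep; rewrite !ffunE.
      apply/esym/sub_ordering_eq => u v lt_uv.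
      have := implyP (forallP (spread u) v) lt_uv; rewrite !ffunE.
      apply: contraTT; rewrite -ordering_ltN => [/sep|]; first by lia.
      by apply: contraTneq lt_uv => ->; rewrite ordering_irr.
    by rewrite (bigD1 uv) //= (le_trans uv_bad) // lerDl.
  apply/andP; split; apply: le_expect => o'; have := ptw o';
    by rewrite ler_norml => /andP[].
rewrite expect_sum /=; set q := (X in _ <= _ * X).
have q_ge0 : 0 <= q.
  by rewrite /q addr_ge0 ?divr_ge0 ?exprn_ge0 ?ler0n.
apply: (@le_trans _ _ (\sum_(uv : L * L) q)); last first.
  by rewrite sumr_const card_prod mulnn -[X in X <= _]mulr_natl.
apply: ler_sum => -[u v] _; rewrite /bad /=.
have [_|uv] := eqVneq u v; first by rewrite expect_cst.
rewrite expectD; apply: lerD; first exact: prob_near_ranks.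
rewrite ler_pdivlMr ?exprn_gt0 ?ltr0n //.
exact: prob_cross_rank.
Qed.

End RanksDetermine.

(** Letting the number of reserved points tend to infinity, the probability of
    an ordering is expressed by the law of the ranks alone. *)
Lemma rank_law_unique (R : realType) (P : sgraph -> Prop)
    (M M' : ordering_model R P) (L : sgraph) (PL : P L) :
    consistent M -> consistent M' -> (forall N, P (aug L N)) ->
    rank_law M [set: L] -> rank_law M' [set: L] ->
  M L PL =1 M' L PL.
Proof.
move=> cM cM' PN law law' o; apply/eqP; rewrite -subr_eq0 -normr_le0.
apply: (@eq0_of_mulrn_le _ _ (6 * (#|L| ^ 2)%:R) 1) => k k_gt0.
(* With N = k^3 and g = k^2 both g / N and N / g^2 are of order 1 / k. *)
have g_gt0 : (0 < k ^ 2)%N by rewrite expn_gt0 k_gt0.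
have := ordering_vs_ranks cM PL (PN (k ^ 3)%N) o law g_gt0.
have := ordering_vs_ranks cM' PL (PN (k ^ 3)%N) o law' g_gt0.
set q := \sum_(a | _) _; set l : R := (#|L| ^ 2)%:R.
set b := (2 * k ^ 2)%:R / _ + _ => le' le.
have k0 : 0 < k%:R :> R by rewrite ltr0n.
have kb : k%:R * b <= 3.
  rewrite /b mulrDr; apply: (@le_trans _ _ (2 + 1)); last by lra.
  apply: lerD.
    rewrite mulrA ler_pdivrMr ?ltr0n // -!natrM ler_nat.
    by rewrite mulnCA -expnS leq_mul2l leqnSn.
  rewrite mulrA -natrM -expnS -natrX -expnM divff //.
  by rewrite pnatr_eq0 -lt0n expn_gt0 k_gt0.
have l0 : 0 <= l by rewrite ler0n.
have tri : `|M L PL o - M' L PL o| <= l * b + l * b.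
  rewrite -(subrKA q); apply: le_trans (ler_normD _ _) _.
  by apply: lerD => //; rewrite distrC.
apply: (@le_trans _ _ (k%:R * (l * b + l * b))).
  by rewrite ler_wpM2l // ltW.
have -> : k%:R * (l * b + l * b) = 2 * l * (k%:R * b) by ring.
have -> : 6 * l = 2 * l * 3 by ring.
by apply: ler_wpM2l => //; rewrite mulr_ge0.
Qed.

(** * Embeddings between amalgams and disjoint unions *)

Lemma induced_embedding_comp (G1 G2 G3 : sgraph) (f : G2 -> G3)
    (g : G1 -> G2) :
  induced_embedding f -> induced_embedding g -> induced_embedding (f \o g).
Proof.
move=> [f_inj f_adj] [g_inj g_adj].
by split=> [|x y]; [exact: inj_comp | rewrite /= f_adj].
Qed.

Lemma val_embedding (G : sgraph) (S : {set G}) :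
  @induced_embedding (induced S) G val.
Proof. by split => //; apply: val_inj. Qed.

Lemma inl_union_embedding (G H : sgraph) :
  @induced_embedding G (disjoint_union G H) inl.
Proof. by split => // x y []. Qed.

Lemma inr_union_embedding (G H : sgraph) :
  @induced_embedding H (disjoint_union G H) inr.
Proof. by split => // x y []. Qed.

Definition union_map (G1 G2 H1 H2 : sgraph) (f : G1 -> H1) (g : G2 -> H2)
    (u : disjoint_union G1 G2) : disjoint_union H1 H2 :=
  match u with inl x => inl (f x) | inr y => inr (g y) end.

Lemma union_map_embedding (G1 G2 H1 H2 : sgraph) (f : G1 -> H1)
    (g : G2 -> H2) :
    induced_embedding f -> induced_embedding g ->
  induced_embedding (union_map f g).
Proof.
move=> [f_inj f_adj] [g_inj g_adj]; split.
  by move=> [x|x] [y|y] //= []; [move/f_inj-> | move/g_inj->].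
by move=> [x|x] [y|y] //=.
Qed.

Section Copies.

Variables (G : sgraph) (S : {set G}) (n : nat).

Definition copy (i : 'I_n) (x : G) : amalgam S n :=
  match boolP (x \in S) with
  | AltTrue xS => inr (exist _ x xS)
  | AltFalse xS => inl (i, exist _ x xS)
  end.

Lemma copy_in i x (xS : x \in S) : copy i x = inr (exist _ x xS).
Proof.
rewrite /copy; case: {-}_ / boolP => xS'; last by case/negP: xS'.
by congr inr; apply/val_inj.
Qed.

Lemma copy_notin i x (xS : x \notin S) : copy i x = inl (i, exist _ x xS).
Proof.
rewrite /copy; case: {-}_ / boolP => xS'; first by case/negP: xS.
by congr (inl (_, _)); apply/val_inj.
Qed.

Lemma copy_embedding i : induced_embedding (copy i).
Proof.
split => x y.
  have [xS|xS] := boolP (x \in S); have [yS|yS] := boolP (y \in S);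
    rewrite ?(copy_in _ xS) ?(copy_notin _ xS) ?(copy_in _ yS)
      ?(copy_notin _ yS) //.
    by case.
  by case.
have [xS|xS] := boolP (x \in S); have [yS|yS] := boolP (y \in S);
  rewrite ?(copy_in _ xS) ?(copy_notin _ xS) ?(copy_in _ yS)
    ?(copy_notin _ yS) //=.
by rewrite eqxx.
Qed.

Definition two_copies (i j : 'I_n)
    (u : disjoint_union (induced (~: S)) (induced (~: S))) : amalgam S n :=
  match u with inl x => copy i (val x) | inr y => copy j (val y) end.

(** Distinct copies meet in [S] only, and the amalgam has no edges between
    their other vertices. *)
Lemma two_copies_embedding i j : i != j -> induced_embedding (two_copies i j).
Proof.
move=> ij; have ji : j != i by rewrite eq_sym.
have [[i_inj i_adj] [j_inj j_adj]] := (copy_embedding i, copy_embedding j).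
have out (x : induced (~: S)) : val x \notin S.
  by have := valP x; rewrite inE.
split=> [[x|x] [y|y]|[x|x] [y|y]] /=.
- by move/i_inj/val_inj->.
- rewrite (copy_notin _ (out x)) (copy_notin _ (out y)) => -[/eqP].
  by rewrite (negbTE ij).
- rewrite (copy_notin _ (out x)) (copy_notin _ (out y)) => -[/eqP].
  by rewrite (negbTE ji).
- by move/j_inj/val_inj->.
- exact: i_adj.
- by rewrite (copy_notin _ (out x)) (copy_notin _ (out y)) /= (negbTE ij).
- by rewrite (copy_notin _ (out x)) (copy_notin _ (out y)) /= (negbTE ji).
- exact: j_adj.
Qed.

Definition widen_amalgam m (le_nm : (n <= m)%N) (u : amalgam S n) :
    amalgam S m :=
  match u with inl (i, x) => inl (widen_ord le_nm i, x) | inr x => inr x end.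

Lemma widen_amalgam_embedding m (le_nm : (n <= m)%N) :
  induced_embedding (widen_amalgam le_nm).
Proof.
split; last by move=> [[i x]|x] [[j y]|y].
move=> [[i x]|x] [[j y]|y] //= [] //.
  by move=> /ord_inj -> ->.
by move=> ->.
Qed.

End Copies.

(** The reserved points of any augmentation are provided by a large
    enough edgeless graph. *)
Lemma aug_to_edgeless (G H : sgraph) (N m : nat) (phi : G -> H) :
    induced_embedding phi -> (#|{: G * 'I_N}| <= m)%N ->
  exists psi : aug G N -> disjoint_union H (edgeless m), induced_embedding psi.
Proof.
move=> [phi_inj phi_adj] le_m.
exists (fun u : aug G N => match u with
  | inl x => inl (phi x) | inr p => inr (widen_ord le_m (enum_rank p)) end).
split; last by move=> [x|x] [y|y] //=.
move=> [x|x] [y|y] //= []; first by move/phi_inj->.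
by move/ord_inj/enum_rank_inj->.
Qed.

(** * The law of the ranks in two disjoint copies of a graph *)

Section Doubling.

Variables (R : realType) (P : sgraph -> Prop).
Hypothesis P_closed : forall (H G : sgraph) (phi : H -> G),
  induced_embedding phi -> P G -> P H.
Hypothesis P_amalgam : forall G : sgraph, P G -> (2 <= #|G|)%N ->
  exists S : {set G},
    [/\ S != set0, S \proper [set: G] &
        forall n : nat, (1 <= n)%N ->
          P (disjoint_union
               (disjoint_union (amalgam S n) (amalgam S n))
               (edgeless n))].
Variable M : ordering_model R P.
Hypothesis M_consistent : consistent M.

Lemma rank_law_edgeless (K : sgraph) (D : {set K}) :
  (forall x y : K, adj x y = false) -> rank_law M D.
Proof.
move=> K_edgeless; move Dn: #|D| => n; elim: n D Dn => [|n IHn] D Dn.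
  move/cards0_eq: Dn => -> N PN a; rewrite cards0 expr0 invr1.
  rewrite -[RHS](expect_cst (M PN) 1); apply: eq_expect => o.
  by case: forall_inP => // -[] x; rewrite inE.
have [x xD] : exists x, x \in D by apply/set0Pn; rewrite -card_gt0 Dn.
rewrite -(setD1K xD); apply: rank_law_isolated => //.
  by rewrite !inE eqxx.
by apply: IHn; move: Dn; rewrite (cardsD1 x) xD => -[].
Qed.

Lemma P_aug_amalgams (G : sgraph) (S : {set G}) :
    (forall n : nat, (1 <= n)%N ->
      P (disjoint_union (disjoint_union (amalgam S n) (amalgam S n))
           (edgeless n))) ->
  forall n N, P (aug (disjoint_union (amalgam S n) (amalgam S n)) N).
Proof.
move=> PS n N; set L := disjoint_union _ _.
pose m := (n + #|{: L * 'I_N}|).+1.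
have le_nm : (n <= m)%N by rewrite /m; lia.
have le_m : (#|{: L * 'I_N}| <= m)%N by rewrite /m; lia.
have w_emb := widen_amalgam_embedding S le_nm.
have [psi psi_emb] := aug_to_edgeless (union_map_embedding w_emb w_emb) le_m.
by apply: (P_closed psi_emb); apply: PS.
Qed.

Lemma mem_inl_imset (I J : finType) (A : {set I}) (u : I + J) :
  (u \in inl @: A) = if u is inl x then x \in A else false.
Proof.
case: u => x; first by rewrite mem_imset // => ? ? [].
by apply/imsetP => -[].
Qed.

Lemma mem_inr_imset (I J : finType) (A : {set J}) (u : I + J) :
  (u \in inr @: A) = if u is inr x then x \in A else false.
Proof.
case: u => x; last by rewrite mem_imset // => ? ? [].
by apply/imsetP => -[].
Qed.

Lemma rank_law_imset (K L : sgraph) (D : {set K}) (phi : K -> L) :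
  induced_embedding phi -> rank_law M D -> rank_law M (phi @: D).
Proof.
move=> phi_emb lawD N PN a.
rewrite (card_imset _ phi_emb.1) -(rank_law_embedding P_closed M_consistent lawD
  phi_emb PN (a \o phi)).
by apply: eq_prob => o; rewrite forall_in_imset.
Qed.

Section TwoCopies.

Variables (G : sgraph) (S : {set G}).
Hypothesis lawT :
  rank_law M [set: disjoint_union (induced (~: S)) (induced (~: S))].
Variables (n : nat) (L : sgraph) (s : amalgam S n -> L).
Hypothesis s_embedding : induced_embedding s.
Variables (N : nat) (PN : P (aug L N)) (a : G -> 'I_N.+1).

Let outside (i : 'I_n) (o : total_ordering (aug L N)) : bool :=
  [forall x in ~: S, rank o (s (copy S i x)) == a x].

Let outsideE (i : 'I_n) o : outside i o =
  [forall x : induced (~: S), rank o (s (copy S i (val x))) == a (val x)].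
Proof.
apply/forall_inP/forallP => [h x|h x xS]; first by apply: h; apply: valP.
exact: (h (Sub x xS)).
Qed.

Let card_outside : #|induced (~: S)| = #|~: S|.
Proof. by rewrite /= card_sig; apply: eq_card => x; rewrite !inE. Qed.

Lemma prob_two_copies (i j : 'I_n) : i != j ->
  prob (M PN) (fun o => outside i o && outside j o) =
  (N.+1%:R ^- #|~: S|) ^+ 2.
Proof.
move=> ij; have emb := induced_embedding_comp s_embedding
  (two_copies_embedding S ij).
have := rank_law_embedding P_closed M_consistent lawT emb PN
  (fun u => match u with inl x => a (val x) | inr y => a (val y) end).
rewrite cardsT card_sum card_outside exprD invfM -expr2 => <-.
apply: eq_prob => o; rewrite !outsideE.
apply/andP/forall_inP => [[/forallP hi /forallP hj] [x|x] _ //|h].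
  exact: hi.
  exact: hj.
by split; apply/forallP => x; [apply: (h (inl x)) | apply: (h (inr x))].
Qed.

Lemma prob_one_copy (i : 'I_n) : (1 < n)%N ->
  prob (M PN) (outside i) = N.+1%:R ^- #|~: S|.
Proof.
move=> n_gt1.
have [j ij] : exists j : 'I_n, i != j.
  exists (if val i == 0%N then Ordinal n_gt1 else Ordinal (ltnW n_gt1)).
  by case: ifP => [/eqP i0|i0]; rewrite -val_eqE /= ?i0.
have emb := induced_embedding_comp s_embedding (two_copies_embedding S ij).
pose D : {set disjoint_union (induced (~: S)) (induced (~: S))} :=
  inl @: [set: induced (~: S)].
have lawD : rank_law M D by apply: rank_law_sub.
have := rank_law_embedding P_closed M_consistent lawD emb PN
  (fun u => match u with inl x => a (val x) | inr y => a (val y) end).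
rewrite card_imset => [|x y []//]; rewrite cardsT card_outside => <-.
apply: eq_prob => o; rewrite outsideE forall_in_imset.
by apply: eq_forallb => x; rewrite inE.
Qed.

End TwoCopies.

(** Induction on [G].  The rank law holds on the two copies of [S] and for the
    two copies of its complement, by the induction hypothesis for the two induced
    subgraphs; the two copies of the complement are then added to those of [S]
    one after the other.  Each time one side of the disjoint union runs through
    the copies of [G] in its amalgam while the other side stays fixed. *)
Lemma rank_law_double (G : sgraph) :
  P G -> (0 < #|G|)%N -> rank_law M [set: disjoint_union G G].
Proof.
move Gn: #|G| => n; elim/ltn_ind: n G Gn => n IHn G Gn PG n_gt0.
have [n_le1|n_gt1] := leqP n 1.
  apply: rank_law_edgeless => -[x|x] [y|y] //=.
    by rewrite (fintype_le1P _ x y) ?adj_irr // Gn.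
  by rewrite (fintype_le1P _ x y) ?adj_irr // Gn.
rewrite -Gn in n_gt1.
have [S [S_neq0 S_proper PS]] := P_amalgam PG n_gt1.
pose L k := disjoint_union (amalgam S k) (amalgam S k).
have PL k N : P (aug (L k) N) by apply: P_aug_amalgams.
have law_induced (T : {set G}) : T != set0 -> T \proper [set: G] ->
    rank_law M [set: disjoint_union (induced T) (induced T)].
  move=> T0 T1; have cardT : #|induced T| = #|T|.
    by rewrite /= card_sig; apply: eq_card => x; rewrite !inE.
  apply: (IHn #|T|); rewrite ?card_gt0 //.
    by rewrite -Gn -cardsT; apply: proper_card.
  exact: P_closed (val_embedding T) PG.
have lawS := law_induced S S_neq0 S_proper.
have lawT : rank_law M
    [set: disjoint_union (induced (~: S)) (induced (~: S))].
  apply: law_induced.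
    by apply: contraTneq S_proper => S0; rewrite -[S]setCK S0 setC0 properxx.
  by rewrite properT; apply: contraNneq S_neq0 => S0; rewrite -[S]setCK S0 setCT.
(* The fixed side uses the copy of index 0, which exists as soon as some i does. *)
pose first k (i : 'I_k) : 'I_k :=
  Ordinal (leq_ltn_trans (leq0n i) (ltn_ord i)).
have firstE k (i j : 'I_k) : first k i = first k j by apply: val_inj.
have copyS k (i j : 'I_k) x : x \in S -> copy S i x = copy S j x.
  by move=> xS; rewrite !(copy_in _ xS).
pose K := disjoint_union G G.
pose DS : {set K} := inl @: S :|: inr @: S.
have law_S : rank_law M DS.
  have emb := union_map_embedding (val_embedding S) (val_embedding S).
  have := rank_law_imset emb lawS; congr (rank_law M _).
  apply/setP => u; rewrite inE; apply/imsetP/orP => [[[x|x] _ ->]|].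
  - by left; apply: imset_f; apply: valP.
  - by right; apply: imset_f; apply: valP.
  - by case=> /imsetP[x xS ->]; [exists (inl (Sub x xS)) | exists (inr (Sub x xS))].
have law_right : rank_law M (DS :|: inr @: ~: S).
  apply: (rank_law_extend P_closed M_consistent
    (L := L) (e := fun k i => union_map (copy S (first k i)) (copy S i))).
  - apply/pred0P => -[x|x] /=;
      rewrite !inE !(mem_inl_imset, mem_inr_imset) ?inE;
      by case: (x \in S).
  - by move=> k N _; apply: PL.
  - by move=> k i; apply: union_map_embedding; apply: copy_embedding.
  - move=> k i j u; rewrite inE => /orP[] /imsetP[x xS ->] /=.
      by rewrite (firstE k i j).
    by rewrite (copyS k i j).
  - move=> k N PN i j a ij; rewrite card_imset => [|x y []//].
    rewrite -(prob_two_copies lawT (inr_union_embedding _ _) PN (a \o inr) ij).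
    by apply: eq_prob => o; rewrite !forall_in_imset.
  - move=> k N PN i a k_gt1; rewrite card_imset => [|x y []//].
    rewrite -(prob_one_copy lawT (inr_union_embedding _ _) PN (a \o inr) i k_gt1).
    by apply: eq_prob => o; rewrite !forall_in_imset.
  - exact: law_S.
have -> : [set: K] = (DS :|: inr @: ~: S) :|: inl @: ~: S.
  apply/setP => -[x|x]; rewrite !inE !(mem_inl_imset, mem_inr_imset) ?inE;
    by case: (x \in S).
apply: (rank_law_extend P_closed M_consistent
  (L := L) (e := fun k i => union_map (copy S i) (copy S (first k i)))).
- apply/pred0P => -[x|x] /=;
    rewrite !inE !(mem_inl_imset, mem_inr_imset) ?inE;
    by case: (x \in S).
- by move=> k N _; apply: PL.
- by move=> k i; apply: union_map_embedding; apply: copy_embedding.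
- move=> k i j u; rewrite !inE => /orP[/orP[]|] /imsetP[x xS ->] /=.
  + by rewrite (copyS k i j).
  + by rewrite (firstE k i j).
  + by rewrite (firstE k i j).
- move=> k N PN i j a ij; rewrite card_imset => [|x y []//].
  rewrite -(prob_two_copies lawT (inl_union_embedding _ _) PN (a \o inl) ij).
  by apply: eq_prob => o; rewrite !forall_in_imset.
- move=> k N PN i a k_gt1; rewrite card_imset => [|x y []//].
  rewrite -(prob_one_copy lawT (inl_union_embedding _ _) PN (a \o inl) i k_gt1).
  by apply: eq_prob => o; rewrite !forall_in_imset.
- exact: law_right.
Qed.

End Doubling.

(** * Uniformity *)

Theorem theorem5p1 (R : realType) (P : sgraph -> Prop)
    (P_iso : graph_property P) (P_hereditary : hereditary P)
    (P_amalgam : forall G : sgraph, P G -> (2 <= #|G|)%N ->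
      exists S : {set G},
        [/\ S != set0, S \proper [set: G] &
            forall n : nat, (1 <= n)%N ->
              P (disjoint_union
                   (disjoint_union (amalgam S n) (amalgam S n))
                   (edgeless n))]) :
  uniform_property R P.
Proof.
split=> [|M M_consistent G PG o]; first exact: uniform_model_consistent.
have P_closed := induced_embedding_closed P_iso P_hereditary.
have [G_le1|G_gt1] := leqP #|G| 1.
  have mass1 (mu : random_ordering R G) : mu o = 1.
    rewrite -(ordering_mass_sum1 mu) (bigD1 o) //= big1 ?addr0 // => o'.
    case/eqP; apply: sub_ordering_eq => x y.
    by rewrite (fintype_le1P G_le1 x y) ordering_irr.
  by rewrite !mass1.
have [S [_ _ PS]] := P_amalgam G PG G_gt1.
pose K := disjoint_union G G.
have PK N : P (aug K N).
  have PL := P_aug_amalgams P_closed PS 1 N.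
  have emb := copy_embedding S (@ord0 0).
  exact: P_closed (aug_map_embedding N (union_map_embedding emb emb)) PL.
have PGG : P K by apply: P_closed (inl_embedding K 0) (PK 0%N).
have law (M' : ordering_model R P) : consistent M' -> rank_law M' [set: K].
  by move=> cM'; exact: (rank_law_double P_closed P_amalgam cM' PG (ltnW G_gt1)).
have emb := inl_union_embedding G G.
have U_consistent := @uniform_model_consistent R P.
rewrite -!prob_pred1 (prob_pullback M_consistent PG PGG emb).
rewrite (prob_pullback U_consistent PG PGG emb); apply: eq_bigr => o' _.
by congr (_ * _); apply: rank_law_unique => //; apply: law.
Qed.
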